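(* There exists a sequence $d=(d_1,d_2,\dots)$ of non-negative integers such that for all $k\in\mathbb{N}$ (with $k\ge 1$), the $d$-copycut graph $G_k$ satisfies $\alpha(G_k)=|V(G_k)|/F_k$, where $F_1=1$ and $F_{k+1}=F_k+\frac{1}{F_k}$ for all $k\ge 1$.
   Context: All graphs are finite and simple. $\alpha(G)$ denotes the size of a largest independent set of $G$. Construction of the $d$-copycut graphs $G_1,G_2,\dots$ for a sequence $d=(d_1,d_2,\dots)$ of non-negative integers. The vertex set of each $G_k$ is partitioned into branch vertices and inner vertices; the branch vertices form an independent set. $G_1$ is the one-vertex graph, whose vertex is a branch vertex. For $k\ge 1$, $G_{k+1}$ is obtained from $G_k$ as follows. Let $n_k=|V(G_k)|$, let $b_1,\dots,b_l$ be an enumeration of the branch vertices of $G_k$, and let $x_1,\dots,x_{n_k}$ be an enumeration of $V(G_k)$. (1) Take $d_k$ pairwise disjoint copies $G_k^1,\dots,G_k^{d_k}$ of $G_k$, and for each $r\in\{1,\dots,l\}$ identify the $d_k$ copies of $b_r$ into a single vertex $c_r$. Call the resulting graph $G_k^*$; its branch vertices are $c_1,\dots,c_l$. (If $d_k=0$, $G_k^*$ is the edgeless graph on $c_1,\dots,c_l$.) (2) For each branch vertex $v$ of $G_k^*$, add a new disjoint copy $G_k(v)$ of $G_k$. (3) Replace each branch vertex $v$ of $G_k^*$ by $n_k$ pairwise non-adjacent copies $v_1,\dots,v_{n_k}$, each having the same neighbourhood as $v$ has in $G_k^*$. (4) For each branch vertex $v$ of $G_k^*$ and each $i\in\{1,\dots,n_k\}$,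 add an edge between $v_i$ and the vertex corresponding to $x_i$ in $G_k(v)$. The resulting graph is $G_{k+1}$; its branch vertices are all the vertices $v_i$ ($v$ a branch vertex of $G_k^*$, $1\le i\le n_k$), and all its other vertices are inner vertices. *)

(* Defs.v *)
From HB Require Import structures.
From mathcomp Require Import all_boot all_order all_algebra.
Set Implicit Arguments.
Unset Strict Implicit.
Unset Printing Implicit Defensive.
Import Order.TTheory GRing.Theory Num.Theory.

(* A finite simple graph with a distinguished independent set of branch
   vertices; the other vertices are the inner ones. *)
Record bgraph := BGraph {
  vertex :> finType;
  adj : rel vertex;
  adj_sym : symmetric adj;
  adj_irr : irreflexive adj;
  branch : pred vertex;
  branch_indep : forall x y, branch x -> branch y -> ~~ adj x y
}.
Arguments adj {G} : rename.
Arguments branch {G} : rename.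

Definition branch_of (G : bgraph) : finType := {x : G | branch x}.
Definition inner_of (G : bgraph) : finType := {x : G | ~~ branch x}.

Definition independent (G : bgraph) (A : {set G}) : bool :=
  [forall x in A, forall y in A, ~~ adj x y].

Definition alpha (G : bgraph) : nat :=
  \max_(A : {set G} | independent A) #|A|.

Lemma one_adj_sym : symmetric (fun _ _ : unit => false).
Proof. by []. Qed.
Lemma one_adj_irr : irreflexive (fun _ _ : unit => false).
Proof. by []. Qed.
Lemma one_branch_indep (x y : unit) : true -> true -> ~~ false.
Proof. by []. Qed.

Definition one_vertex : bgraph :=
  @BGraph unit (fun _ _ => false) one_adj_sym one_adj_irr
          (fun=> true) one_branch_indep.

(* G^*: [inl b] is the vertex obtained by identifying the d copies of the
   branch vertex b, and [inr (r, x)] is the copy of the inner vertex x in the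
   r-th copy of G.  Two identified vertices are never adjacent, since the
   branch vertices of G are independent. *)
Section Star.
Variables (d : nat) (G : bgraph).

Definition star_vertex : finType := (branch_of G + 'I_d * inner_of G)%type.

Definition star_adj (u v : star_vertex) : bool :=
  match u, v with
  | inl _, inl _ => false
  | inl b, inr (_, x) => adj (val b) (val x)
  | inr (_, x), inl b => adj (val x) (val b)
  | inr (r, x), inr (s, y) => (r == s) && adj (val x) (val y)
  end.

Definition star_branch (u : star_vertex) : bool :=
  if u is inl _ then true else false.

Lemma star_adj_sym : symmetric star_adj.
Proof.
by case=> [b|[r x]] [c|[s y]] //=; rewrite adj_sym // eq_sym.
Qed.

Lemma star_adj_irr : irreflexive star_adj.
Proof. by case=> [b|[r x]] //=; rewrite adj_irr andbF. Qed.

Lemma star_branch_indep u v :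
  star_branch u -> star_branch v -> ~~ star_adj u v.
Proof. by case: u v => [b|[r x]] [c|[s y]]. Qed.

Definition star : bgraph :=
  BGraph star_adj_sym star_adj_irr star_branch_indep.

End Star.

(* One step of the construction, from G_k = G and d_k = d to G_(k+1).  The
   vertices of G index both the copies v_i of a branch vertex v of G^* and the
   vertices of the new graph G(v):
     [inl (inl u)]      is the inner vertex u of G^*;
     [inl (inr (v, i))] is v_i, for v a branch vertex of G^*;
     [inr (v, i)]       is the vertex i of G(v). *)
Section Step.
Variables (d : nat) (G : bgraph).
Let S : bgraph := star d G.

Definition next_vertex : finType :=
  (inner_of S + branch_of S * G + branch_of S * G)%type.

Definition next_proj (p : inner_of S + branch_of S * G) : S :=
  match p with
  | inl u => val u
  | inr (v, _) => val v
  end.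

Definition next_adj (p q : next_vertex) : bool :=
  match p, q with
  | inl a, inl b => adj (next_proj a) (next_proj b)
  | inl (inr (v, i)), inr (w, j) => (v == w) && (i == j)
  | inr (v, i), inl (inr (w, j)) => (v == w) && (i == j)
  | inr (v, i), inr (w, j) => (v == w) && adj i j
  | _, _ => false
  end.

Definition next_branch (p : next_vertex) : bool :=
  if p is inl (inr _) then true else false.

Lemma next_adj_sym : symmetric next_adj.
Proof.
case=> [[u|[v i]]|[v i]] [[u'|[w j]]|[w j]] //=; try by rewrite star_adj_sym.
- by rewrite eq_sym [i == _]eq_sym.
- by rewrite eq_sym [i == _]eq_sym.
- by rewrite eq_sym adj_sym.
Qed.

Lemma next_adj_irr : irreflexive next_adj.
Proof.
by case=> [[u|[v i]]|[v i]] /=; rewrite ?star_adj_irr // adj_irr andbF.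
Qed.

Lemma next_branch_indep p q :
  next_branch p -> next_branch q -> ~~ next_adj p q.
Proof.
case: p q => [[u|[v i]]|[v i]] [[u'|[w j]]|[w j]] //= _ _.
exact: star_branch_indep (valP v) (valP w).
Qed.

Definition copycut_step : bgraph :=
  BGraph next_adj_sym next_adj_irr next_branch_indep.

End Step.

(* The sequences d, G and F are indexed from 1: [copycut d k] is G_k and
   [F k] is F_k for 1 <= k, the values at index 0 being irrelevant. *)
Fixpoint copycut (d : nat -> nat) (k : nat) : bgraph :=
  match k with
  | (_.+1 as i).+1 => copycut_step (d i) (copycut d i)
  | _ => one_vertex
  end.

Fixpoint F (k : nat) : rat :=
  match k with
  | (_.+1 as i).+1 => (F i + (F i)^-1)%R
  | _ => 1%R
  end.

(* Main.v *)
(** Write [n] for the order of [G_k] and [b] for its number of branch vertices,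
    and take [d_k = n - b].  Then [(n, b)] evolves by
    [n' = (n - b)^2 + 2 b n = n^2 + b^2] and [b' = b n], so [n / b] satisfies
    the recursion of [F].  It remains to see that [alpha = b] persists.  The
    branch vertices form an independent set.  Conversely, let [A] be independent
    in [G_(k+1)] and let [W] be the set of branch vertices [v] of [G_k^*] with
    some [v_i] in [A].  Each [v] in [W] contributes at most [n] vertices (one
    for each edge of the matching), any other [v] at most [alpha = b] (within
    [G(v)]), and each of the [n - b] copies of [G_k] at most [b - |W|] inner
    vertices, since these together with [W] are independent in [G_k].  In total
    [|A| <= |W| n + (b - |W|) b + (n - b) (b - |W|) = b n]. *)
Require Import Defs.
From mathcomp Require Import all_boot all_order all_algebra.
From mathcomp Require Import zify ring.
Import Order.TTheory GRing.Theory Num.Theory.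
Local Open Scope ring_scope.
Set Implicit Arguments.
Unset Strict Implicit.
Unset Printing Implicit Defensive.

Section Independent.
Local Open Scope nat_scope.
Variable G : bgraph.

Lemma independentP (A : {set G}) :
  reflect {in A &, forall x y, ~~ adj x y} (independent A).
Proof.
apply: (iffP forallP) => [iA x y xA yA | iA x].
  by have /implyP/(_ xA)/forallP/(_ y)/implyP/(_ yA) := iA x.
by apply/implyP=> xA; apply/forallP=> y; apply/implyP; apply: iA.
Qed.

Lemma leq_alpha (A : {set G}) : independent A -> #|A| <= alpha G.
Proof. by move=> iA; rewrite /alpha; apply: (@leq_bigmax_cond _ _ _ A). Qed.

Lemma alpha_leq m :
  (forall A : {set G}, independent A -> #|A| <= m) -> alpha G <= m.
Proof. by move=> Am; apply/bigmax_leqP. Qed.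

Lemma card_branch_of : #|branch_of G| = #|[set x : G | branch x]|.
Proof. by rewrite card_sig cardsE. Qed.

Lemma card_inner_branch : #|inner_of G| + #|branch_of G| = #|G|.
Proof. by rewrite !card_sig addnC; apply: cardC. Qed.

Lemma card_branch_leq_alpha : #|branch_of G| <= alpha G.
Proof.
rewrite card_branch_of; apply/leq_alpha/independentP => x y.
by rewrite !inE; apply: branch_indep.
Qed.

(** The images of [W] and [J] in [G] are disjoint, and branch vertices are independent, so the union
    of the images is an independent set of [G]. *)
Lemma independent_split_leq_alpha (W : {set branch_of G})
    (J : {set inner_of G}) :
  (forall v x, v \in W -> x \in J -> ~~ adj (val v) (val x)) ->
  (forall x y, x \in J -> y \in J -> ~~ adj (val x) (val y)) ->
  #|W| + #|J| <= alpha G.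
Proof.
move=> WJ JJ.
rewrite -(card_imset _ val_inj) -(card_imset (mem J) val_inj).
set B := _ @: W; set C := _ @: J.
have dBC : [disjoint B & C].
  apply/pred0P=> x /=; apply/negP=> /andP[/imsetP[v _ ->] /imsetP[y _ vy]].
  by have := valP y; rewrite /= -vy (valP v).
move: dBC; rewrite -leq_card_setU => /eqP <-.
apply/leq_alpha/independentP => x y.
rewrite !inE => /orP[] /imsetP[u uA ->] /orP[] /imsetP[w wA ->].
- exact: branch_indep (valP u) (valP w).
- exact: WJ.
- by rewrite adj_sym; apply: WJ.
- exact: JJ.
Qed.

End Independent.

Section Step.
Local Open Scope nat_scope.
Variables (d : nat) (G : bgraph).
Local Notation S := (star d G).
Local Notation G' := (copycut_step d G).

Definition star_inner (p : 'I_d * inner_of G) : inner_of S :=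
  exist (fun u : S => ~~ branch u) (inr p) isT.

Definition star_merge (v : branch_of G) : branch_of S :=
  exist (fun u : S => branch u) (inl v) isT.

Lemma star_inner_bij : bijective star_inner.
Proof.
apply: inj_card_bij => [p q /(congr1 val)[] //|].
rewrite -(card_codom (f := star_inner)) => [|p q /(congr1 val)[] //].
apply/subset_leq_card/subsetP=> -[[v|p] u] // _.
by apply/codomP; exists p; apply: val_inj.
Qed.

Lemma star_merge_bij : bijective star_merge.
Proof.
apply: inj_card_bij => [p q /(congr1 val)[] //|].
rewrite -(card_codom (f := star_merge)) => [|p q /(congr1 val)[] //].
apply/subset_leq_card/subsetP=> -[[v|p] u] // _.
by apply/codomP; exists v; apply: val_inj.
Qed.

(** These three families reach every vertex of [G'] exactly once, in coordinates taken from [G]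
    alone. *)
Definition inner_vertex (r : 'I_d) (x : inner_of G) : G' :=
  inl (inl (star_inner (r, x))).
Definition branch_vertex (v : branch_of G) (i : G) : G' :=
  inl (inr (star_merge v, i)).
Definition attached_vertex (v : branch_of G) (i : G) : G' :=
  inr (star_merge v, i).

(** Source of all the counts below: [f] is the constant 1, the indicator of branch vertices, or that
    of a given set. *)
Lemma sum_step (f : G' -> nat) :
  \sum_p f p = \sum_r \sum_x f (inner_vertex r x)
    + \sum_v \sum_i (f (branch_vertex v i) + f (attached_vertex v i)).
Proof.
rewrite !big_sumType /= -addnA; congr (_ + _).
  rewrite pair_big (reindex _ (onW_bij _ star_inner_bij)).
  by apply: eq_bigr => -[].
under [in RHS]eq_bigr do rewrite big_split.
rewrite big_split !pair_big /=.
have bij2 : bijective (fun p : branch_of G * G => (star_merge p.1, p.2)).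
  have [h hK Kh] := star_merge_bij.
  by exists (fun p => (h p.1, p.2)) => -[v i] /=; rewrite ?hK ?Kh.
by rewrite !(reindex _ (onW_bij _ bij2)).
Qed.

Lemma card_step :
  #|G'| = d * #|inner_of G| + 2 * #|branch_of G| * #|G|.
Proof.
rewrite -sum1_card sum_step; under eq_bigr do rewrite sum_nat_const muln1.
under [X in _ + X]eq_bigr do rewrite sum_nat_const.
by rewrite !sum_nat_const card_ord mulnA [_ * (1 + 1)]mulnC mulnA.
Qed.

Lemma card_branch_step : #|branch_of G'| = #|branch_of G| * #|G|.
Proof.
rewrite card_sig -sum1_card big_mkcond sum_step /=.
rewrite big1 ?add0n => [|r _]; last by rewrite big1.
under eq_bigr do rewrite sum_nat_const muln1.
by rewrite sum_nat_const.
Qed.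

Lemma card_set_step (A : {set G'}) :
  #|A| = \sum_r #|[set x | inner_vertex r x \in A]|
    + \sum_v (#|[set i | branch_vertex v i \in A]|
              + #|[set i | attached_vertex v i \in A]|).
Proof.
rewrite -sum1_card big_mkcond sum_step; congr (_ + _).
  by apply: eq_bigr => r _; rewrite -big_mkcond sum1dep_card.
by apply: eq_bigr => v _; rewrite big_split -!big_mkcond !sum1dep_card.
Qed.

End Step.

Lemma alpha_step (G : bgraph) : alpha G = #|branch_of G| ->
  alpha (copycut_step (#|G| - #|branch_of G|) G)
    = (#|branch_of G| * #|G|)%N.
Proof.
set b := #|branch_of G|; set d := (_ - _)%N => alphaG.
apply/eqP; rewrite eqn_leq -(card_branch_step d) card_branch_leq_alpha andbT.
rewrite card_branch_step -/b; apply: alpha_leq => A /independentP iA.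
pose W := [set v | [exists i, branch_vertex d v i \in A]].
have Wb : (#|W| <= b)%N by apply: max_card.
have innerA r : (#|[set x | inner_vertex r x \in A]| <= b - #|W|)%N.
  rewrite leq_subRL // -alphaG.
  apply: independent_split_leq_alpha => [v x|x y]; rewrite !inE.
    (* Each copy [v_i] keeps the neighbours of [v] in every copy of [G], so any one [v_i] in [A]
       excludes them all. *)
    by move=> /existsP[i vA] xA; apply: iA vA xA.
  by move=> xA yA; have := iA _ _ xA yA; rewrite /= eqxx.
have pairA v : (#|[set i | branch_vertex d v i \in A]|
    + #|[set i | attached_vertex d v i \in A]|
    <= if v \in W then #|G| else b)%N.
  case: ifPn => [_|].
    set B := [set _ | _]; set C := [set _ | _].
    (* The matching joins [v_i] to vertex [i] of [G(v)], so no index occurs in both sets. *)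
    have dBC : [disjoint B & C].
      apply/pred0P=> i /=; apply/negP; rewrite !inE => /andP[iB iC].
      by have := iA _ _ iB iC; rewrite /= !eqxx.
    by move: dBC; rewrite -leq_card_setU => /eqP <-; apply: max_card.
  rewrite inE negb_exists => /forallP vW.
  rewrite (_ : [set i | branch_vertex d v i \in A] = set0); last first.
    by apply/setP=> i; rewrite !inE (negPf (vW i)).
  rewrite cards0 -alphaG; apply/leq_alpha/independentP=> i j.
  by rewrite !inE => iC jC; have := iA _ _ iC jC; rewrite /= eqxx.
rewrite card_set_step.
apply: (@leq_trans (d * (b - #|W|) + (#|W| * #|G| + (b - #|W|) * b))%N).
  apply: leq_add.
    apply: leq_trans (leq_sum _ (fun r _ => innerA r)) _.
    by rewrite sum_nat_const card_ord.
  apply: leq_trans (leq_sum _ (fun v _ => pairA v)) _.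
  rewrite (bigID (mem W)) /=; apply: leq_add.
    by rewrite (eq_bigr (fun=> #|G|)) ?sum_nat_const // => v ->.
  rewrite (eq_bigr (fun=> b)) => [|v /negPf -> //].
  by rewrite sum_nat_const /b -(cardC (mem W)) addKn.
(* Since [b <= n], the truncated difference [d] satisfies [d + b = n], and the bound becomes
   [|W| n + (b - |W|) n]. *)
have := card_inner_branch G; rewrite -/b /d; nia.
Qed.

(** The pairs [(#|G_k|, #|branch_of G_k|)] for [1 <= k]. *)
Fixpoint orders (k : nat) : nat * nat :=
  match k with
  | (_.+1 as i).+1 =>
      let: (n, b) := orders i in (n ^ 2 + b ^ 2, b * n)%N
  | _ => (1, 1)%N
  end.

Lemma ordersS k : orders k.+2 =
  let: (n, b) := orders k.+1 in (n ^ 2 + b ^ 2, b * n)%N.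
Proof. by []. Qed.

(** Computed from the numerical recursion, because the graphs themselves depend on this sequence. *)
Definition copies (k : nat) : nat := ((orders k).1 - (orders k).2)%N.

(** The claims go through one induction: the first identifies [copies] with [n - b], which
    [alpha_step] needs to carry the second on. *)
Lemma copycut_orders k (G := copycut copies k.+1) :
  [/\ orders k.+1 = (#|G|, #|branch_of G|), alpha G = #|branch_of G|
    & (0 < #|branch_of G|)%N].
Proof.
rewrite {}/G; elim: k => [|k].
  have b1 : #|branch_of one_vertex| = 1%N by rewrite card_sig card_unit.
  rewrite /= b1 card_unit; split=> //.
  apply/eqP; rewrite eqn_leq -{2}b1 card_branch_leq_alpha andbT.
  by apply: alpha_leq => A _; rewrite -card_unit max_card.
set G := copycut copies k.+1 => -[ordG alphaG b_gt0].
rewrite [copycut _ _](_ : _ = copycut_step (copies k.+1) G) //.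
have := card_inner_branch G; move: ordG alphaG b_gt0.
set n := #|G|; set b := #|branch_of G| => ordG alphaG b_gt0 nE.
rewrite ordersS /copies ordG /= card_step card_branch_step -/n -/b alpha_step //.
by split; [congr (_, _) | |]; nia.
Qed.

(** The step is [n/b + b/n = (n^2 + b^2)/(bn)], with [n] and [b] nonzero. *)
Lemma F_orders k : F k.+1 = (orders k.+1).1%:R / (orders k.+1).2%:R.
Proof.
elim: k => [|k IHk]; first by rewrite /= divr1.
have [ordG _ b_gt0] := copycut_orders k.
rewrite [F _](_ : _ = F k.+1 + (F k.+1)^-1) // IHk.
rewrite ordersS.
move: ordG b_gt0 (card_inner_branch (copycut copies k.+1)).
case: (orders k.+1) => n b [<- <-] b_gt0 nE /=.
have n0 : n%:R != 0 :> rat by rewrite pnatr_eq0; lia.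
have b0 : b%:R != 0 :> rat by rewrite pnatr_eq0; lia.
by rewrite natrD !natrX natrM; field; rewrite n0 b0.
Qed.

Theorem theorem3p3 :
  exists d : nat -> nat, forall k : nat, (1 <= k)%N ->
    (alpha (copycut d k))%:R = (#|copycut d k|)%:R / F k :> rat.
Proof.
exists copies => -[//|k] _.
have [ordG -> b_gt0] := copycut_orders k.
(* The goal is [b = n / (n / b)], which reduces to [n] being nonzero. *)
rewrite F_orders ordG [_.1]/= [_.2]/= invf_div mulrCA divff ?mulr1 //.
by rewrite pnatr_eq0 -lt0n -card_inner_branch ltn_addl.
Qed.
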